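(* A classical Sasakian space is generalized Sasakian. That is, if $(M,\phi,\eta,\xi,g)$ is a classical Sasakian manifold, then the induced structure $(M,\Phi_\phi,E_+,E_-,G)$ with $\Phi_\phi=\begin{pmatrix}\phi&0\\0&-\phi^*\end{pmatrix}$, $E_+=\xi$, $E_-=\eta$, $G=\begin{pmatrix}0&g^{-1}\\ g&0\end{pmatrix}$ is a generalized Sasakian structure on $M$.
   Context: A classical Sasakian manifold $(M,\phi,\eta,\xi,g)$ is a normal contact metric manifold: $\phi$ is a $(1,1)$ tensor, $\xi$ the Reeb vector field, $\eta$ the contact one-form, $g$ the compatible Riemannian metric. $\phi^*$ is defined by $(\phi^*\alpha)(X)=\alpha(\phi(X))$. On $TM\oplus T^*M$ use the neutral metric $\langle X+\alpha,Y+\beta\rangle=\frac12(\beta(X)+\alpha(Y))$ and the Courant bracket $[[X+\alpha,Y+\beta]]=[X,Y]+\mathcal L_X\beta-\mathcal L_Y\alpha-\frac12 d(\iota_X\beta-\iota_Y\alpha)$. Adjoints of endomorphisms of $TM\oplus T^*M$ are taken with respect to $\langle\cdot,\cdot\rangle$, and $(E\otimes F)(u)=2\langle F,u\rangle E$. A two-form is viewed as a map from tangent to cotangent bundle by interior product, and a bivector as a map from cotangent to tangent bundle; juxtaposition is composition. A generalized almost contact structure on $M$ is a triple $(\Phi,E_\pm)$ with $\Phi$ an endomorphism of $TM\oplus T^*M$ and $E_\pm$ sections of $TM\oplus T^*M$ such that $\Phi+\Phi^*=0$, $\Phi\circ\Phi=-Id+E_+\otimes E_-+E_-\otimes E_+$,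 $\langle E_\pm,E_\pm\rangle=0$, $2\langle E_+,E_-\rangle=1$. Let $E^{(1,0)}$, $E^{(0,1)}$ be the $\pm\sqrt{-1}$ eigenbundles of $\Phi$ in $(TM\oplus T^*M)\otimes\mathbb C$, $L_{E_\pm}$ the line bundle spanned by $E_\pm$, and $L^\pm=L_{E_\pm}\oplus E^{(1,0)}$. The structure is strong if both $L^+$ and $L^-$ are closed under the Courant bracket, and is a normal generalized contact structure if it is strong and $[[E_+,E_-]]=0$. A generalized metric is an automorphism $G$ of $TM\oplus T^*M$ with $G^*=G$, $G^2=1$ and $\langle G\cdot,\cdot\rangle$ positive definite. The structure together with $G$ is a generalized (almost) contact metric structure if $-\Phi G\Phi=G-E_+\otimes E_+-E_-\otimes E_-$. Canonical Poisson structure of a normal generalized contact structure: with $e_\pm=pr_{TM}E_\pm$, put $\pi_M=\pi_0+e_+\wedge e_-$. Here, locally, $E^{(1,0)}\oplus E^{(0,1)}=(E_+\oplus E_-)^\perp\otimes\mathbb C$ is identified with $T_{\mathbb C}W\oplus T^*_{\mathbb C}W$ for a transversal $W$ to the foliation generated by $e_+,e_-$, $\Phi$ restricts there to a generalized complex structure, and $\pi_0$ is the canonical Poisson bivector of that generalized complex structure extended to $M$. The canonical Poisson bivector of a generalized complex structure $\mathcal J$ is the $T^*\to T$ component of $\mathcal J$; since $\Phi$ vanishes on $E_\pm$, the extension of $\pi_0$ to $M$ is the $T^*M\to TM$ component of $\Phi$, $\pi_0(\alpha)=pr_{TM}(\Phi\alpha)$. A normal generalized contact metric space $(M,\Phi,E_+,E_-,G)$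 is generalized Sasakian if $d\eta\neq0$ and $I+e^t(d\eta)\pi_M$ is invertible as a map from $T^*M$ to $T^*M$ for all $t\in\mathbb R$, where $\eta=pr_{T^*M}E_++pr_{T^*M}E_-$. *)

(* Defs.v *)
From HB Require Import structures.
From mathcomp Require Import all_boot all_order all_algebra all_fingroup.
From mathcomp Require Import all_classical all_reals all_analysis.
From mathcomp Require Import ring.
Set Implicit Arguments.
Unset Strict Implicit.
Unset Printing Implicit Defensive.
Import Order.TTheory GRing.Theory Num.Theory.
Import numFieldNormedType.Exports.
Local Open Scope classical_set_scope.
Local Open Scope ring_scope.

(* Smooth manifolds. *)

(* C^k on an open set U: continuous, with partial derivatives that exist on U
   and are C^(k-1) there.  The values of f outside U play no role. *)
Fixpoint Ck_on (R : realType) (m k : nat) (U : set 'rV[R]_m)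
    (f : 'rV[R]_m -> R) : Prop :=
  (forall x, U x -> {for x, continuous f}) /\
  (if k is k'.+1 then
     forall i : 'I_m,
       (forall x, U x -> derivable f x (delta_mx 0 i)) /\
       Ck_on k' U (fun x => 'D_(delta_mx 0 i) f x)
   else True).

Definition smooth_on (R : realType) (m : nat) (U : set 'rV[R]_m)
    (f : 'rV[R]_m -> R) : Prop := forall k, Ck_on k U f.

Record chart (R : realType) (m : nat) (T : topologicalType) := Chart {
  chart_dom : set T;
  chart_map : T -> 'rV[R]_m;
  chart_inv : 'rV[R]_m -> T;
  chart_open : open chart_dom;
  chart_img_open : open (chart_map @` chart_dom);
  chart_mapK : forall x, chart_dom x -> chart_inv (chart_map x) = x;
  chart_map_continuous : forall x, chart_dom x -> {for x, continuous chart_map};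
  chart_inv_continuous :
    forall y, (chart_map @` chart_dom) y -> {for y, continuous chart_inv}
}.

(* Nonempty; connectedness is not required. *)
Record manifold (R : realType) (m : nat) := Manifold {
  points :> topologicalType;
  atlas : set (chart R m points);
  points_hausdorff : hausdorff_space points;
  points_second_countable : @second_countable points;
  points_nonempty : exists p : points, True;
  atlas_cover : forall p : points, exists2 c, atlas c & chart_dom c p;
  atlas_compatible : forall c c' : chart R m points, atlas c -> atlas c' ->
    forall i : 'I_m,
      smooth_on (chart_map c @` (chart_dom c `&` chart_dom c'))
        (fun y => chart_map c' (chart_inv c y) 0 i)
}.

Section Ck_closure.
Context {R : realType} {m : nat}.
Implicit Types (U : set 'rV[R]_m) (f g : 'rV[R]_m -> R).

Lemma Ck_on_ext k U f g : open U -> (forall x, U x -> f x = g x) ->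
  Ck_on k U f -> Ck_on k U g.
Proof.
move=> oU; have nfg f' g' x : (forall x, U x -> f' x = g' x) -> U x ->
    \forall y \near x, f' y = g' y :> R.
  by move=> fg Ux; have := open_nbhs_nbhs (conj oU Ux); apply: filterS => y /fg.
have cfg f' g' : (forall x, U x -> f' x = g' x) ->
    (forall x, U x -> {for x, continuous f'}) ->
    forall x, U x -> {for x, continuous g'}.
  move=> fg cf x Ux; change (g' @ x --> (g' x : R)); rewrite -fg//.
  exact: (cvg_trans (near_eq_cvg (nfg _ _ _ fg Ux)) (cf x Ux)).
elim: k f g => [|k IH] f g fg /= [cf df]; split => //; try exact: cfg cf.
move=> i; have [d1 d2] := df i; split.
  by move=> x Ux; apply: (near_eq_derivable (nfg _ _ _ fg Ux)); exact: d1.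
apply: IH d2 => x Ux /=.
by apply: near_eq_derive; exact: nfg.
Qed.

Lemma Ck_on_cst k U (a : R) : Ck_on k U (cst a).
Proof.
elim: k a => [|k IH] a /=; first by split=> // x _; exact: cst_continuous.
split=> [x _|i]; first exact: cst_continuous.
split; first by move=> x _; exact: derivable_cst.
rewrite (_ : (fun x => _) = cst 0); first exact: IH.
by apply/funext => x; rewrite derive_cst.
Qed.

Lemma Ck_on_S k U f : Ck_on k.+1 U f -> Ck_on k U f.
Proof.
elim: k f => [|k IH] f; first by case.
move=> [cf df]; split => // i; have [d1 d2] := df i; split => //; exact: IH.
Qed.

Lemma Ck_onD k U f g : open U -> Ck_on k U f -> Ck_on k U g ->
  Ck_on k U (f \+ g).
Proof.
move=> oU; elim: k f g => [|k IH] f g /= [cf df] [cg dg]; split => //.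
- by move=> x Ux; exact: (cvgD (cf x Ux) (cg x Ux)).
- by move=> x Ux; exact: (cvgD (cf x Ux) (cg x Ux)).
move=> i; have [f1 f2] := df i; have [g1 g2] := dg i; split.
  by move=> x Ux; apply: derivableD; [exact: f1|exact: g1].
apply: Ck_on_ext (IH _ _ f2 g2) => //.
by move=> x Ux /=; rewrite deriveD//; [exact: f1|exact: g1].
Qed.

Lemma Ck_onM k U f g : open U -> Ck_on k U f -> Ck_on k U g ->
  Ck_on k U (f \* g).
Proof.
move=> oU; elim: k f g => [|k IH] f g Hf Hg.
  case: Hf Hg => [cf _] [cg _]; split => // x Ux.
  exact: (cvgM (cf x Ux) (cg x Ux)).
have [cf df] := Hf; have [cg dg] := Hg; split.
  by move=> x Ux; exact: (cvgM (cf x Ux) (cg x Ux)).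
move=> i; have [f1 f2] := df i; have [g1 g2] := dg i; split.
  by move=> x Ux; apply: derivableM; [exact: f1|exact: g1].
have H1 := IH _ _ (Ck_on_S Hf) g2; have H2 := IH _ _ (Ck_on_S Hg) f2.
apply: Ck_on_ext (Ck_onD oU H1 H2) => //.
by move=> x Ux /=; rewrite deriveM//; [exact: f1|exact: g1].
Qed.

End Ck_closure.

(* The R-algebra C^oo(M): a commutative ring and an R-module. *)

Section Cinf.
Context {R : realType} {m : nat} (M : manifold R m).

Definition smooth (f : M -> R) : Prop :=
  forall c, atlas c -> smooth_on (chart_map c @` chart_dom c) (f \o chart_inv c).

Definition smooth_pred : {pred M -> R} := [pred f | `[< smooth f >]].

Lemma smooth_cst (a : R) : smooth (cst a).
Proof. by move=> c _ k; exact: Ck_on_cst. Qed.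

Lemma smoothD (f g : M -> R) : smooth f -> smooth g -> smooth (f + g).
Proof.
move=> sf sg c Ac k; have o := @chart_img_open _ _ _ c.
exact: Ck_onD o (sf c Ac k) (sg c Ac k).
Qed.

Lemma smoothM (f g : M -> R) : smooth f -> smooth g -> smooth (f * g).
Proof.
move=> sf sg c Ac k; have o := @chart_img_open _ _ _ c.
exact: Ck_onM o (sf c Ac k) (sg c Ac k).
Qed.

Lemma smooth_predP f : reflect (smooth f) (f \in smooth_pred).
Proof. exact: asboolP. Qed.

Lemma smooth_subring_closed : subring_closed smooth_pred.
Proof.
split=> [|f g /smooth_predP sf /smooth_predP sg|
  f g /smooth_predP sf /smooth_predP sg]; apply/smooth_predP.
- exact: (smooth_cst 1).
- rewrite (_ : f - g = f + cst (-1) * g).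
    by apply: smoothD => //; apply: smoothM => //; exact: smooth_cst.
  by apply/funext => p; rewrite !fctE mulN1r.
- exact: smoothM.
Qed.

HB.instance Definition _ :=
  GRing.isSubringClosed.Build _ smooth_pred smooth_subring_closed.

Lemma smooth_scaler_closed : GRing.scaler_closed smooth_pred.
Proof.
move=> a f /smooth_predP sf; apply/smooth_predP.
by rewrite (_ : a *: f = cst a * f) //; apply: smoothM => //; exact: smooth_cst.
Qed.

HB.instance Definition _ :=
  GRing.isScaleClosed.Build R (M -> R) smooth_pred smooth_scaler_closed.

Record cinf := MkCinf { cinf_fun :> M -> R; _ : cinf_fun \in smooth_pred }.

HB.instance Definition _ := [isSub for cinf_fun].
HB.instance Definition _ := [Choice of cinf by <:].
HB.instance Definition _ := 
  GRing.SubChoice_isSubComPzRing.Build (M -> R) smooth_pred cinf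
    (smooth_subring_closed).
HB.instance Definition _ := [SubZmodule_isSubLmodule of cinf by <:].

End Cinf.

(* Vector fields are the derivations of C^oo(M), one-forms the C^oo(M)-linear
   functionals on vector fields; both are C^oo(M)-modules.  Bundle maps of TM,
   T*M and their sum are the C^oo(M)-linear maps of these modules. *)

Lemma lie_aux (A : comPzRingType) (f g xf yf xg yg xyf yxf xyg yxg : A) :
  xyf * g + yf * xg + (xf * yg + f * xyg)
    - (yxf * g + xf * yg + (yf * xg + f * yxg)) =
  (xyf - yxf) * g + f * (xyg - yxg).
Proof. ring. Qed.

Section Fields.
Context {R : realType} {m : nat} (M : manifold R m).

Definition derivation (X : cinf M -> (cinf M)^o) : Prop :=
  (forall (a : R) (f g : cinf M), X (a *: f + g) = a *: (X f : cinf M) + X g) /\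
  (forall f g : cinf M, X (f * g) = X f * g + f * X g).

Definition derivation_pred : {pred cinf M -> (cinf M)^o} :=
  [pred X | `[< derivation X >]].

Lemma derivationP X : reflect (derivation X) (X \in derivation_pred).
Proof. exact: asboolP. Qed.

Lemma cinf_scaleE (a : R) (f : cinf M) : a *: f = (a *: (1 : cinf M) : cinf M) * f.
Proof.
apply: val_inj; apply/funext => p.
by change (a * f p = (a * 1) * f p); rewrite mulr1.
Qed.

Lemma derivation_submod_closed : GRing.subsemimod_closed derivation_pred.
Proof.
split; first split.
- apply/derivationP; split=> [a f g|f g].
    by change (0 = a *: (0 : cinf M) + 0); rewrite scaler0 addr0.
  by change (0 = 0 * g + f * 0); rewrite mul0r mulr0 addr0.
- move=> X Y /derivationP[X1 X2] /derivationP[Y1 Y2]; apply/derivationP.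
  split=> [a f g|f g].
    change (X (a *: f + g) + Y (a *: f + g) =
      a *: (X f + Y f : cinf M) + (X g + Y g)).
    by rewrite X1 Y1 scalerDr addrACA.
  change (X (f * g) + Y (f * g) = (X f + Y f) * g + f * (X g + Y g)).
  by rewrite X2 Y2 mulrDl mulrDr addrACA.
- move=> h X /derivationP[X1 X2]; apply/derivationP.
  split=> [a f g|f g].
    change (h * X (a *: f + g) = a *: (h * X f : cinf M) + h * X g).
    by rewrite X1 mulrDr (cinf_scaleE a (X f)) (cinf_scaleE a (h * _)) mulrCA.
  change (h * X (f * g) = (h * X f) * g + f * (h * X g)).
  by rewrite X2 mulrDr mulrA [h * (f * _)]mulrCA.
Qed.

HB.instance Definition _ := GRing.isSubSemiModClosed.Build (cinf M)
  (cinf M -> (cinf M)^o) derivation_pred derivation_submod_closed.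

Record vfield :=
  MkVfield { vfield_fun :> cinf M -> (cinf M)^o; _ : vfield_fun \in derivation_pred }.

HB.instance Definition _ := [isSub for vfield_fun].
HB.instance Definition _ := [Choice of vfield by <:].
HB.instance Definition _ := [SubChoice_isSubLmodule of vfield by <:].

Definition oneform_pred : {pred vfield -> (cinf M)^o} :=
  [pred al | `[< linear al >]].

Lemma oneformP al : reflect (linear al) (al \in oneform_pred).
Proof. exact: asboolP. Qed.

Lemma oneform_submod_closed : GRing.subsemimod_closed oneform_pred.
Proof.
split; first split.
- apply/oneformP => h X Y.
  by change (0 = h * 0 + 0 :> cinf M); rewrite mulr0 addr0.
- move=> a b /oneformP al /oneformP bl; apply/oneformP => h X Y.
  change (a (h *: X + Y) + b (h *: X + Y) = h * (a X + b X) + (a Y + b Y)).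
  by rewrite al bl mulrDr addrACA.
- move=> h a /oneformP al; apply/oneformP => k X Y.
  change (h * a (k *: X + Y) = k * (h * a X) + h * a Y).
  by rewrite al mulrDr [k * (h * _)]mulrCA.
Qed.

HB.instance Definition _ := GRing.isSubSemiModClosed.Build (cinf M)
  (vfield -> (cinf M)^o) oneform_pred oneform_submod_closed.

Record oneform :=
  MkOneform { oneform_fun :> vfield -> (cinf M)^o; _ : oneform_fun \in oneform_pred }.

HB.instance Definition _ := [isSub for oneform_fun].
HB.instance Definition _ := [Choice of oneform by <:].
HB.instance Definition _ := [SubChoice_isSubLmodule of oneform by <:].

Lemma vfield_lin (X : vfield) (a : R) (f g : cinf M) :
  X (a *: f + g) = a *: (X f : cinf M) + X g.
Proof. by case: X => X /= /derivationP[]. Qed.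

Lemma vfieldM (X : vfield) (f g : cinf M) : X (f * g) = X f * g + f * X g.
Proof. by case: X => X /= /derivationP[]. Qed.

Lemma oneform_lin (al : oneform) : linear al.
Proof. by case: al => al /= /oneformP. Qed.

Lemma vfieldD (X : vfield) (f g : cinf M) : X (f + g) = X f + X g.
Proof.
by have := vfield_lin X 1 f g; rewrite !scale1r.
Qed.

Lemma vfieldB (X : vfield) (f g : cinf M) : X (f - g) = X f - X g.
Proof.
by have := vfield_lin X (-1) g f; rewrite !scaleN1r addrC => ->; rewrite addrC.
Qed.

Lemma vfield_ext (X Y : vfield) : (forall f, X f = Y f) -> X = Y.
Proof. by move=> XY; apply: val_inj; apply/funext. Qed.

Lemma oneform_ext (al be : oneform) : (forall X, al X = be X) -> al = be.
Proof. by move=> ab; apply: val_inj; apply/funext. Qed.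

Lemma oneformD (al : oneform) (X Y : vfield) : al (X + Y) = al X + al Y.
Proof. by have := oneform_lin al 1 X Y; rewrite !scale1r. Qed.

Lemma oneformZ (al : oneform) (h : cinf M) (X : vfield) :
  al (h *: X) = h * al X.
Proof.
have := oneform_lin al h X 0; rewrite addr0 => ->.
have := oneform_lin al 1 0 0; rewrite !scale1r addr0.
by move/(congr1 (fun z => z - al 0)); rewrite subrr addrK => <-; rewrite addr0.
Qed.

Lemma lie_subproof (X Y : vfield) :
  (fun f : cinf M => X (Y f) - Y (X f) : (cinf M)^o) \in derivation_pred.
Proof.
apply/derivationP; split=> [a f g|f g].
  change (X (Y (a *: f + g)) - Y (X (a *: f + g)) =
    a *: (X (Y f) - Y (X f) : cinf M) + (X (Y g) - Y (X g))).
  rewrite (vfield_lin Y a f g) (vfield_lin X a f g).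
  rewrite (vfield_lin X a (Y f)) (vfield_lin Y a (X f)).
  by rewrite scalerBr opprD addrACA.
change (X (Y (f * g)) - Y (X (f * g)) =
  (X (Y f) - Y (X f)) * g + f * (X (Y g) - Y (X g))).
rewrite (vfieldM Y f g) (vfieldM X f g).
rewrite (vfieldD X (Y f * g)) (vfieldD Y (X f * g)).
rewrite (vfieldM X (Y f)) (vfieldM X f) (vfieldM Y (X f)) (vfieldM Y f).
exact: lie_aux.
Qed.

Definition lie (X Y : vfield) : vfield := MkVfield (lie_subproof X Y).


Lemma lieE (X Y : vfield) f : lie X Y f = X (Y f) - Y (X f).
Proof. by []. Qed.

Lemma vfield_linE (h : cinf M) (X Y : vfield) (f : cinf M) :
  (h *: X + Y) f = h * X f + Y f.
Proof. by []. Qed.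

Lemma lieZr (X Y Z : vfield) (h : cinf M) :
  lie X (h *: Y + Z) = h *: lie X Y + ((X h) *: Y + lie X Z).
Proof.
apply: vfield_ext => f.
rewrite lieE !vfield_linE vfieldD vfieldM !lieE.
ring.
Qed.

Lemma differential_subproof (f : cinf M) :
  (fun X : vfield => X f : (cinf M)^o) \in oneform_pred.
Proof. exact/oneformP. Qed.
Definition differential (f : cinf M) : oneform :=
  MkOneform (differential_subproof f).

(* The exterior derivative of a one-form, with no factor 1/2. *)
Definition extd (al : oneform) (X Y : vfield) : cinf M :=
  X (al Y) - Y (al X) - al (lie X Y).

Lemma lieder_subproof (X : vfield) (al : oneform) :
  (fun Y : vfield => X (al Y) - al (lie X Y) : (cinf M)^o) \in oneform_pred.
Proof.
apply/oneformP => h Y Z.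
change (X (al (h *: Y + Z)) - al (lie X (h *: Y + Z)) =
  h * (X (al Y) - al (lie X Y)) + (X (al Z) - al (lie X Z))).
rewrite lieZr !oneformD !oneformZ vfieldD vfieldM.
ring.
Qed.
Definition lieder (X : vfield) (al : oneform) : oneform :=
  MkOneform (lieder_subproof X al).

Lemma contract_extd_subproof (al : oneform) (X : vfield) :
  (fun Y : vfield => extd al X Y : (cinf M)^o) \in oneform_pred.
Proof.
apply/oneformP => h Y Z.
change (extd al X (h *: Y + Z) = h * extd al X Y + extd al X Z).
rewrite /extd lieZr !oneformD !oneformZ vfieldD vfieldM vfield_linE.
ring.
Qed.
(* The two-form d al as a map from tangent to cotangent bundle. *)
Definition contract_extd (al : oneform) (X : vfield) : oneform :=
  MkOneform (contract_extd_subproof al X).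

Lemma pullback_subproof (phi : {linear vfield -> vfield}) (al : oneform) :
  (fun X : vfield => al (phi X) : (cinf M)^o) \in oneform_pred.
Proof.
by apply/oneformP => h X Y; rewrite linearP oneform_lin.
Qed.
(* phi^* al = al o phi *)
Definition pullback (phi : {linear vfield -> vfield}) (al : oneform) : oneform :=
  MkOneform (pullback_subproof phi al).

End Fields.

(* Riemannian metrics and classical Sasakian structures. *)

Section Sasakian.
Context {R : realType} {m : nat} (M : manifold R m).

Definition vfield_zero_at (X : vfield M) (p : M) : Prop := forall f, X f p = 0.
Definition oneform_zero_at (al : oneform M) (p : M) : Prop :=
  forall Y, al Y p = 0.

(* A metric is an isomorphism g : TM -> T*M, given with its inverse, that is
   symmetric and positive definite at each point: g(X,X) >= 0 with equality
   exactly where X vanishes. *)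
Record riem_metric := RiemMetric {
  flat :> {linear vfield M -> oneform M};
  sharp : oneform M -> vfield M;
  flatK : cancel flat sharp;
  sharpK : cancel sharp flat;
  metric_sym : forall X Y, flat X Y = flat Y X;
  metric_ge0 : forall X p, 0 <= (flat X X : cinf M) p;
  metric_eq0 : forall X p, (flat X X : cinf M) p = 0 <-> vfield_zero_at X p
}.

Definition nijenhuis (phi : {linear vfield M -> vfield M}) (X Y : vfield M)
    : vfield M :=
  phi (phi (lie X Y)) + lie (phi X) (phi Y)
    - phi (lie (phi X) Y) - phi (lie X (phi Y)).

End Sasakian.

(* eta /\ (d eta)^n evaluated on 2n+1 vector fields, up to the nonzero constant
   of the alternation. *)
Definition contact_volume (R : realType) (n : nat) (M : manifold R (n.*2).+1)
    (eta : oneform M) (X : 'I_(n.*2).+1 -> vfield M) : cinf M :=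
  \sum_(s : 'S_(n.*2).+1) (-1) ^+ s *
    ((eta (X (s ord0)) : cinf M) *
     \prod_(i < n) extd eta (X (s (inord (i.*2).+1))) (X (s (inord (i.*2).+2)))).

(* In the customary normalization d'eta = extd eta / 2, the contact metric
   condition is d'eta(X,Y) = g(X, phi Y) and normality is
   [phi,phi] + 2 d'eta (x) xi = 0. *)
Record sasakian (R : realType) (n : nat) (M : manifold R (n.*2).+1)
    (phi : {linear vfield M -> vfield M}) (eta : oneform M) (xi : vfield M)
    (g : riem_metric M) : Prop := Sasakian {
  sasakian_contact : forall p : M, exists X, contact_volume eta X p != 0;
  sasakian_reeb1 : eta xi = 1;
  sasakian_reeb0 : forall X, extd eta xi X = 0;
  sasakian_phi2 : forall X, phi (phi X) = - X + (eta X : cinf M) *: xi;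
  sasakian_compat : forall X Y, g (phi X) (phi Y) = g X Y - eta X * eta Y;
  sasakian_metric : forall X Y, extd eta X Y = 2%:R * (g X (phi Y) : cinf M);
  sasakian_normal : forall X Y,
    nijenhuis phi X Y + extd eta X Y *: xi = 0
}.

(* Generalized structures.  A section of TM (+) T*M is a pair (X, alpha). *)

Section Generalized.
Context {R : realType} {m : nat} (M : manifold R m).

Definition gsec : Type := (vfield M * oneform M)%type.

Definition half : cinf M := (2^-1 : R) *: (1 : cinf M).

Definition pairing (u v : gsec) : cinf M := half * (v.2 u.1 + u.2 v.1).

Definition courant (u v : gsec) : gsec :=
  (lie u.1 v.1,
   lieder u.1 v.2 - lieder v.1 u.2
     - half *: differential (v.2 u.1 - u.2 v.1 : cinf M)).

Definition otimes (E F u : gsec) : gsec := (2%:R * pairing F u) *: E.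

Definition is_adjoint (A B : gsec -> gsec) : Prop :=
  forall u v, pairing (A u) v = pairing u (B v).

Definition gsec_zero_at (u : gsec) (p : M) : Prop :=
  vfield_zero_at u.1 p /\ oneform_zero_at u.2 p.

Record gen_almost_contact (Phi : gsec -> gsec) (Ep Em : gsec) : Prop := {
  gac_linear : linear Phi;
  gac_skew : is_adjoint Phi (fun u => - Phi u);
  gac_square : forall u, Phi (Phi u) = - u + otimes Ep Em u + otimes Em Ep u;
  gac_isop : pairing Ep Ep = 0;
  gac_isom : pairing Em Em = 0;
  gac_pair : 2%:R * pairing Ep Em = 1
}.

(* The complex section u + i v of (TM (+) T*M) (x) C is the pair (u, v); the
   Courant bracket is extended complex-bilinearly. *)
Definition csec : Type := (gsec * gsec)%type.

Definition courantC (z w : csec) : csec :=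
  (courant z.1 w.1 - courant z.2 w.2, courant z.1 w.2 + courant z.2 w.1).

(* Phi z = i z, where i (u + i v) = - v + i u *)
Definition E10 (Phi : gsec -> gsec) (z : csec) : Prop :=
  Phi z.1 = - z.2 /\ Phi z.2 = z.1.

(* Sections of L_E (+) E^(1,0), L_E being the complex line bundle spanned by
   the real section E. *)
Definition Lbundle (Phi : gsec -> gsec) (E : gsec) (z : csec) : Prop :=
  exists (a b : cinf M) (w : csec), E10 Phi w /\ z = (a *: E, b *: E) + w.

Definition courant_closed (L : csec -> Prop) : Prop :=
  forall z w, L z -> L w -> L (courantC z w).

Record normal_gen_contact (Phi : gsec -> gsec) (Ep Em : gsec) : Prop := {
  ngc_almost : gen_almost_contact Phi Ep Em;
  ngc_strongp : courant_closed (Lbundle Phi Ep);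
  ngc_strongm : courant_closed (Lbundle Phi Em);
  ngc_bracket : courant Ep Em = 0
}.

Record gen_metric (G : gsec -> gsec) : Prop := {
  gm_linear : linear G;
  gm_adjoint : is_adjoint G G;
  gm_square : forall u, G (G u) = u;
  gm_ge0 : forall u p, 0 <= pairing (G u) u p;
  gm_eq0 : forall u p, pairing (G u) u p = 0 <-> gsec_zero_at u p
}.

Record normal_gen_contact_metric (Phi : gsec -> gsec) (Ep Em : gsec)
    (G : gsec -> gsec) : Prop := {
  ngcm_normal : normal_gen_contact Phi Ep Em;
  ngcm_metric : gen_metric G;
  ngcm_compat : forall u,
    - Phi (G (Phi u)) = G u - otimes Ep Ep u - otimes Em Em u
}.

(* X /\ Y as a map from cotangent to tangent bundle, al |-> al(X) Y - al(Y) X *)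
Definition bivector (X Y : vfield M) (al : oneform M) : vfield M :=
  (al X : cinf M) *: Y - (al Y : cinf M) *: X.

Definition pi_M (Phi : gsec -> gsec) (Ep Em : gsec) (al : oneform M)
    : vfield M :=
  (Phi (0, al)).1 + bivector Ep.1 Em.1 al.

Record gen_sasakian (Phi : gsec -> gsec) (Ep Em : gsec) (G : gsec -> gsec)
    : Prop := {
  gs_metric : normal_gen_contact_metric Phi Ep Em G;
  gs_d_neq0 : ~ (forall X Y, extd (Ep.2 + Em.2) X Y = 0);
  gs_invertible : forall t : R,
    bijective (fun al : oneform M =>
      al + ((expR t *: (1 : cinf M) : cinf M)
             *: contract_extd (Ep.2 + Em.2) (pi_M Phi Ep Em al)))
}.

Definition Phi_of (phi : {linear vfield M -> vfield M}) (u : gsec) : gsec :=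
  (phi u.1, - pullback phi u.2).

Definition G_of (g : riem_metric M) (u : gsec) : gsec := (sharp g u.2, g u.1).

End Generalized.

(* Main.v *)
Require Import Defs.
From mathcomp Require Import all_boot all_order all_algebra.
From mathcomp Require Import all_classical all_reals all_analysis.
From mathcomp Require Import ring.
Import GRing.Theory.
Local Open Scope ring_scope.

Set Implicit Arguments.
Unset Strict Implicit.
Unset Printing Implicit Defensive.
Import Order.TTheory Num.Theory.

(** The structure induced by a Sasakian manifold is block diagonal, and each of
    the three kinds of conditions becomes classical.

    Integrability.  Let T10 be the bundle of complex vector fields X with
    phi X = i X; since eta o phi = 0, these lie in ker eta.  The bundle
    L^+ = L_xi + E^(1,0) is D + Ann D for D = T10 + C xi, and
    L^- = L_eta + E^(1,0) is D + Ann D for D = T10 ([dirac_sub_T10xi],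
    [dirac_sub_T10]).  Such a D + Ann D is closed under the Courant bracket as
    soon as D is closed under the Lie bracket ([dirac_sub_closed]), because
    every term of the bracket, tested on D, contains a form of Ann D applied to
    D or to a Lie bracket of sections of D.  Normality, with the vanishing
    of d eta (xi, -), gives the involutivity of T10 + C xi
    ([T10xi_lie_closed]).  For T10 one needs moreover that eta vanishes on the
    brackets, that is, that d eta is of type (1,1); this follows from
    d eta = 2 g(-, phi -) and the compatibility of g with phi
    ([T10_lie_closed]).

    Metric.  In the identity for Phi G Phi, the form component is the
    compatibility of g with phi; the vector component is the formula for phi^2,
    once phi is known to be skew for g and xi to be dual to eta.
    Definiteness at a point p uses that X vanishes at p exactly when the
    one-form g X does, which follows from the Cauchy-Schwarz inequality
    ([flat_zero_at]).

    Sasakian conditions.  The Poisson structure pi_M vanishes: Phi maps forms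
    to forms and E_- has no vector part.  Thus I + e^t (d eta) pi_M is the
    identity.  Finally d eta is nonzero because the contact volume
    eta /\ (d eta)^n is nonzero, M is nonempty and n > 0. *)

(** * Calculus of vector fields and one-forms *)

Section Calculus.
Context {R : realType} {m : nat} {M : manifold R m}.
Implicit Types (X Y Z : vfield M) (al be : oneform M) (f h : cinf M).

Lemma vaddE X Y f : (X + Y) f = X f + Y f. Proof. by []. Qed.
Lemma voppE X f : (- X) f = - X f. Proof. by []. Qed.
Lemma vscaleE h X f : (h *: X) f = h * X f. Proof. by []. Qed.
Lemma vzeroE f : (0 : vfield M) f = 0. Proof. by []. Qed.

Definition vfieldE := (vaddE, voppE, vscaleE, vzeroE).

Lemma oaddE al be X : (al + be) X = al X + be X. Proof. by []. Qed.
Lemma ooppE al X : (- al) X = - al X. Proof. by []. Qed.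
Lemma oscaleE h al X : (h *: al) X = h * al X. Proof. by []. Qed.
Lemma ozeroE X : (0 : oneform M) X = 0. Proof. by []. Qed.
Definition oneformE := (oaddE, ooppE, oscaleE, ozeroE).

Lemma vfield0 X : X 0 = 0.
Proof. by have := vfieldB X 0 0; rewrite !subr0 subrr. Qed.

Lemma vfieldN X f : X (- f) = - X f.
Proof. by rewrite -sub0r vfieldB vfield0 sub0r. Qed.

Lemma vfield1 X : X 1 = 0.
Proof.
have := vfieldM X 1 1; rewrite !mulr1 mul1r => h.
by apply: (addrI (X 1)); rewrite addr0.
Qed.

Lemma oneform0 al : al 0 = 0.
Proof. by have := oneformZ al 0 0; rewrite scale0r mul0r. Qed.

Lemma oneformN al X : al (- X) = - al X.
Proof. by rewrite -scaleN1r oneformZ mulN1r. Qed.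

Lemma oneformB al X Y : al (X - Y) = al X - al Y.
Proof. by rewrite oneformD oneformN. Qed.

Definition oneform_linE :=
  (oneformB, @oneformD R m M, oneformN, @oneformZ R m M, oneform0).

(** Reduces an equation of smooth functions to a ring identity modulo the
    hypothesis c = d. *)
Lemma eq_diff (a b c d : cinf M) : c = d -> a - b = c - d -> a = b.
Proof. by move=> ->; rewrite subrr => /eqP; rewrite subr_eq0 => /eqP. Qed.

Lemma lie0r X : lie X 0 = 0.
Proof. by apply: vfield_ext => f; rewrite lieE !vfieldE vfield0 subrr. Qed.

Lemma lieC X Y : lie X Y = - lie Y X.
Proof. by apply: vfield_ext => f; rewrite !vfieldE !lieE opprB. Qed.

Lemma lieNr X Y : lie X (- Y) = - lie X Y.
Proof.
by apply: vfield_ext => f; rewrite !vfieldE !lieE !vfieldE vfieldN; ring.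
Qed.

Lemma lieNl X Y : lie (- X) Y = - lie X Y.
Proof. by rewrite lieC lieNr opprK; exact: lieC. Qed.

Lemma liexx X : lie X X = 0.
Proof. by apply: vfield_ext => f; rewrite lieE subrr. Qed.

Lemma lieDZr X Y Z h : lie X (Y + h *: Z) = lie X Y + h *: lie X Z + X h *: Z.
Proof. by rewrite [Y + _]addrC lieZr addrA addrC addrA. Qed.

Lemma extdC al X Y : extd al X Y = - extd al Y X.
Proof. by rewrite /extd (lieC X Y) oneformN; ring. Qed.

Lemma gsec_ext (u v : gsec M) : u.1 = v.1 -> u.2 = v.2 -> u = v.
Proof. by case: u v => [? ?] [? ?] /= -> ->. Qed.

Lemma half2 : (Defs.half M) * 2%:R = 1.
Proof.
apply: val_inj; apply/funext => p.
by change ((2^-1 * 1) * (1 + 1) = 1 :> R); field.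
Qed.

Lemma courant_formE (u v : gsec M) Z :
  (courant u v).2 Z =
    u.1 (v.2 Z) - v.2 (lie u.1 Z) - (v.1 (u.2 Z) - u.2 (lie v.1 Z))
    - Defs.half M * (Z (v.2 u.1) - Z (u.2 v.1)).
Proof.
change (u.1 (v.2 Z) - v.2 (lie u.1 Z) - (v.1 (u.2 Z) - u.2 (lie v.1 Z))
  - Defs.half M * Z (v.2 u.1 - u.2 v.1) = u.1 (v.2 Z) - v.2 (lie u.1 Z) -
  (v.1 (u.2 Z) - u.2 (lie v.1 Z)) - Defs.half M * (Z (v.2 u.1) - Z (u.2 v.1))).
by rewrite vfieldB.
Qed.

End Calculus.

(** * Courant brackets of a distribution plus its annihilator *)

Section DiracSub.
Context {R : realType} {m : nat} (M : manifold R m).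

(** A pair (X, Y) stands for the complex vector field X + i Y; likewise for
    forms. *)
Definition cvfield : Type := (vfield M * vfield M)%type.
Definition coneform : Type := (oneform M * oneform M)%type.

Definition clie (X Y : cvfield) : cvfield :=
  (lie X.1 Y.1 - lie X.2 Y.2, lie X.1 Y.2 + lie X.2 Y.1).

(** The real and imaginary parts of the equation al(X) = 0. *)
Definition annihilates (al : coneform) (D : cvfield -> Prop) : Prop :=
  forall X, D X -> al.1 X.1 = al.2 X.2 /\ al.1 X.2 = - al.2 X.1.

Definition lie_closed (D : cvfield -> Prop) : Prop :=
  forall X Y, D X -> D Y -> D (clie X Y).

(** The subbundle D + Ann D of the complexified TM + T*M. *)
Definition dirac_sub (D : cvfield -> Prop) (z : csec M) : Prop :=
  D (z.1.1, z.2.1) /\ annihilates (z.1.2, z.2.2) D.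

(** For sections X + a, Y + b of D + Ann D and Z in D, the form part of the
    Courant bracket at Z is
      X(b Z) - b[X,Z] - Y(a Z) + a[Y,Z] - Z(b X - a Y)/2,
    where b Z, a Z, b X, a Y vanish since a, b annihilate D, and b[X,Z],
    a[Y,Z] vanish since D contains the Lie brackets. *)
Lemma dirac_sub_closed D : lie_closed D -> courant_closed (dirac_sub D).
Proof.
move=> lieD [[X1 a1] [X2 a2]] [[Y1 b1] [Y2 b2]] [/= DX aD] [/= DY bD].
split; first exact: lieD DX DY.
case=> Z1 Z2 DZ.
have [aZ1 aZ2] := aD _ DZ; have [bZ1 bZ2] := bD _ DZ.
have [aY1 aY2] := aD _ DY; have [bX1 bX2] := bD _ DX.
have [] := aD _ (lieD _ _ DY DZ); have [] := bD _ (lieD _ _ DX DZ).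
rewrite /clie /= !oneform_linE => bL1 bL2 aL1 aL2.
move: aZ1 aZ2 bZ1 bZ2 aY1 aY2 bX1 bX2 => /= aZ1 aZ2 bZ1 bZ2 aY1 aY2 bX1 bX2.
change ((courant (X1, a1) (Y1, b1)).2 Z1 - (courant (X2, a2) (Y2, b2)).2 Z1 =
  (courant (X1, a1) (Y2, b2)).2 Z2 + (courant (X2, a2) (Y1, b1)).2 Z2 /\
  (courant (X1, a1) (Y1, b1)).2 Z2 - (courant (X2, a2) (Y2, b2)).2 Z2 =
  - ((courant (X1, a1) (Y2, b2)).2 Z1 + (courant (X2, a2) (Y1, b1)).2 Z1)).
rewrite !courant_formE /= aZ1 aZ2 bZ1 bZ2 aY1 aY2 bX1 bX2 !vfieldN.
(* only the terms a[Y,Z] and b[X,Z] are left *)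
split.
  by apply: (eq_diff aL1); apply: (eq_diff (esym bL1)); ring.
by apply: (eq_diff aL2); apply: (eq_diff (esym bL2)); ring.
Qed.

Lemma courant_closed_ext (L L' : csec M -> Prop) :
  (forall z, L z <-> L' z) -> courant_closed L -> courant_closed L'.
Proof. by move=> e cL z w /e Lz /e Lw; apply/e/cL. Qed.

End DiracSub.

(** * The generalized metric of a Riemannian metric *)

Section Riemannian.
Context {R : realType} {m : nat} {M : manifold R m}.
Context (g : riem_metric M).

(** Vanishing of X at p is only known through derivations, so the value of
    g X Y at p is controlled by Cauchy-Schwarz instead of by a local frame:
    g(X + t Y, X + t Y) is nonnegative at p for every real t. *)
Lemma flat_zero_at (X : vfield M) (p : M) :
  vfield_zero_at X p <-> oneform_zero_at (g X) p.
Proof.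
split=> [X0 Y|gX0]; last first.
  by apply/(Defs.metric_eq0 g X p); exact: gX0.
have gXX : (g X X : cinf M) p = 0 by apply/(Defs.metric_eq0 g X p).
pose c (t : R) : cinf M := t *: (1 : cinf M).
set a := (g X Y : cinf M) p; set b := (g Y Y : cinf M) p.
have quad t : 0 <= 2 * t * a + t ^+ 2 * b.
  have := Defs.metric_ge0 g (X + c t *: Y) p.
  rewrite oneformD oneformZ linearD linearZ !oneformE (Defs.metric_sym g Y X).
  change (0 <= (g X X : cinf M) p + (t * 1) * a + (t * 1) * (a + (t * 1) * b)
    -> 0 <= 2 * t * a + t ^+ 2 * b).
  rewrite gXX !mulr1 => h; apply: le_trans h _.
  by rewrite le_eqVlt; apply/orP; left; apply/eqP; ring.
have b0 : 0 <= b := Defs.metric_ge0 g Y p.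
(* the minimizer of the quadratic is - a / b; adding 1 avoids the case b = 0 *)
have := quad (- a / (b + 1)).
have b1 : b + 1 != 0 by rewrite gt_eqF// ltr_wpDl.
rewrite (_ : _ + _ = - (a ^+ 2 * (b + 2) / (b + 1) ^+ 2)); last by field.
rewrite oppr_ge0 => h; apply/eqP; rewrite -sqrf_eq0.
move: h; rewrite pmulr_lle0 ?invr_gt0 ?exprn_gt0 ?ltr_wpDl//.
by rewrite pmulr_lle0 ?ltr_wpDl// => h; rewrite eq_le h sqr_ge0.
Qed.

Lemma sharp_linear : linear (sharp g).
Proof.
by move=> h a b; apply: (can_inj (flatK g)); rewrite linearP !sharpK.
Qed.

Lemma G_of_gen_metric : gen_metric (G_of g).
Proof.
(* forms are measured through sharp, so that both summands are values of g *)
have GE (u : gsec M) p : pairing (G_of g u) u p =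
    2^-1 * ((g (sharp g u.2) (sharp g u.2) : cinf M) p
      + (g u.1 u.1 : cinf M) p).
  rewrite sharpK.
  change (2^-1 * 1 * ((u.2 (sharp g u.2) : cinf M) p + (g u.1 u.1 : cinf M) p) =
    2^-1 * ((u.2 (sharp g u.2) : cinf M) p + (g u.1 u.1 : cinf M) p)).
  by rewrite mulr1.
split.
- move=> h [X a] [Y b]; rewrite /G_of /=.
  by rewrite sharp_linear linearP.
- move=> [X a] [Y b]; rewrite /pairing /G_of /= (Defs.metric_sym g Y X).
  have -> : a (sharp g b) = b (sharp g a).
    by rewrite -{1}(sharpK g a) Defs.metric_sym sharpK.
  by rewrite addrC.
- by move=> [X a]; rewrite /G_of /= sharpK flatK.
- move=> u p; rewrite GE mulr_ge0// ?invr_ge0 ?ler0n//.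
  by rewrite addr_ge0// Defs.metric_ge0.
- move=> u p.
  have := flat_zero_at (sharp g u.2) p; rewrite sharpK => e2.
  have e1 := Defs.metric_eq0 g u.1 p.
  have e3 := Defs.metric_eq0 g (sharp g u.2) p.
  rewrite GE; split=> [/eqP|[/e1 -> /e2/e3 ->]]; last by rewrite addr0 mulr0.
  rewrite mulf_eq0 invr_eq0 pnatr_eq0 /= paddr_eq0 ?Defs.metric_ge0//.
  by move=> /andP[/eqP/e3/e2 ? /eqP/e1].
Qed.

End Riemannian.

(** * Identities of Sasakian tensors *)

Section SasakianTensors.
Context {R : realType} {n : nat} {M : manifold R (n.*2).+1}.
Context {phi : {linear vfield M -> vfield M}} {eta : oneform M}.
Context {xi : vfield M} {g : riem_metric M}.
Context (HS : sasakian phi eta xi g).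
Implicit Types X Y Z : vfield M.

Let eta_xi : eta xi = 1 := sasakian_reeb1 HS.
Let phi2 := sasakian_phi2 HS.

(** The one-form g(-, phi xi) is d eta(-, xi) / 2, which the Reeb condition
    kills. *)
Lemma phi_xi : phi xi = 0.
Proof.
apply: (can_inj (flatK g)); apply: oneform_ext => X.
rewrite linear0 ozeroE Defs.metric_sym -[LHS]mul1r -half2 -mulrA.
by rewrite -(sasakian_metric HS) extdC (sasakian_reeb0 HS) oppr0 mulr0.
Qed.

Lemma phi3 X : phi (phi (phi X)) = - phi X.
Proof.
by rewrite [phi (phi X)]phi2 linearD linearN linearZ /= phi_xi scaler0 addr0.
Qed.

(** Compare the two ways of computing phi^3: phi^2 after phi produces the extra
    term eta(phi X) xi, while phi after phi^2 does not, as phi xi = 0. *)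
Lemma eta_phi X : eta (phi X) = 0.
Proof.
have : eta (phi X) *: xi = 0.
  by apply: (addrI (- phi X)); rewrite -phi2 phi3 addr0.
by move/(congr1 eta); rewrite oneformZ eta_xi mulr1 oneform0.
Qed.

Lemma flat_xi X : g xi X = eta X.
Proof.
apply/eqP; rewrite -subr_eq0; apply/eqP.
have := sasakian_compat HS xi X.
by rewrite phi_xi linear0 ozeroE eta_xi mul1r.
Qed.

(** This is the antisymmetry of d eta. *)
Lemma flat_skew X Y : g (phi X) Y = - g X (phi Y).
Proof.
rewrite Defs.metric_sym -[LHS]mul1r -[in RHS](mul1r (g X _)) -half2 -!mulrA.
by rewrite -!(sasakian_metric HS) extdC mulrN.
Qed.

(** Normality with X = xi: phi commutes with the Lie derivative along xi, up to
    a multiple of xi removed by the outer phi. *)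
Lemma phi2_lie_xi Y : phi (phi (lie xi Y)) = phi (lie xi (phi Y)).
Proof.
have := sasakian_normal HS xi Y.
rewrite /nijenhuis phi_xi (sasakian_reeb0 HS) scale0r addr0.
rewrite (lieC 0) (lieC 0) !lie0r oppr0 linear0 addr0 subr0.
by move/eqP; rewrite subr_eq0 => /eqP.
Qed.

(** Normality with its d eta term, a multiple of xi, removed by applying phi. *)
Lemma phi_lie_phi X Y :
  phi (lie (phi X) (phi Y)) =
  phi (lie X Y) + phi (phi (lie (phi X) Y)) + phi (phi (lie X (phi Y))).
Proof.
have /(congr1 phi) := sasakian_normal HS X Y.
rewrite /nijenhuis linear0 linearD linearZ /= phi_xi scaler0 addr0.
rewrite !linearB linearD /= phi3 => /eqP; rewrite !subr_eq0 => /eqP.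
move=> h; apply: vfield_ext => f; move/(congr1 (fun Z : vfield M => Z f)): h.
rewrite !vfieldE => h.
by apply: (eq_diff h); ring.
Qed.

(** * Involutivity of T10 and of T10 + C xi *)

(** T10 + C xi: the equation phi X = i X modulo xi.  One real equation
    suffices, since applying phi to it gives the other one. *)
Definition T10xi (X : cvfield M) : Prop := phi X.2 = - phi (phi X.1).
(** The complex vector fields X with phi X = i X. *)
Definition T10 (X : cvfield M) : Prop := phi X.2 = X.1 /\ phi X.1 = - X.2.

Lemma T10xi_im (X : cvfield M) : T10xi X -> X.2 = - phi X.1 + eta X.2 *: xi.
Proof.
move/(congr1 phi); rewrite linearN phi3 opprK phi2 => <-.
by rewrite opprD opprK addrNK.
Qed.

(** Under phi, the bracket is tensorial with respect to multiples of xi: the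
    derivative of the coefficient multiplies xi, which phi kills. *)
Lemma phi_lie_addr X Y d :
  phi (lie X (Y + d *: xi)) = phi (lie X Y) - d *: phi (lie xi X).
Proof.
rewrite lieDZr !linearD !linearZ /= phi_xi scaler0 addr0.
by rewrite (lieC X xi) linearN scalerN.
Qed.

Lemma phi_lie_addl X Y b :
  phi (lie (X + b *: xi) Y) = phi (lie X Y) + b *: phi (lie xi Y).
Proof.
by rewrite lieC linearN phi_lie_addr opprB (lieC Y) linearN opprK addrC.
Qed.

(** Write the sections as X - i phi X + i b xi and Y - i phi Y + i d xi with X,
    Y real.  The terms with b and d cancel because phi commutes with the Lie
    derivative along xi; the rest is normality for X and Y. *)
Lemma T10xi_lie_closed : lie_closed T10xi.
Proof.
move=> [X1 X2] [Y1 Y2] /T10xi_im /= -> /T10xi_im /= ->.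
set b := eta X2; set d := eta Y2.
rewrite /T10xi /clie /=.
rewrite !linearD !linearN /= !(phi_lie_addr, phi_lie_addl).
rewrite !(lieNr, lieNl) !liexx linear0 scaler0 subr0 !opprK.
rewrite phi_lie_phi !(linearD, linearN, linearZ) /=.
rewrite !(linearD, linearN, linearZ) -!phi2_lie_xi !phi3 /=.
by apply: vfield_ext => f; rewrite !vfieldE; ring.
Qed.

Lemma T10E (X : cvfield M) :
  T10 X <-> [/\ T10xi X, eta X.1 = 0 & eta X.2 = 0].
Proof.
split=> [[h1 h2]|[h e1 e2]].
  split; first by rewrite /T10xi h2 linearN opprK.
    by rewrite -h1 eta_phi.
  by rewrite -[X.2]opprK -h2 oneformN eta_phi oppr0.
split; first by rewrite h phi2 e1 scale0r addr0 opprK.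
by rewrite [in RHS](T10xi_im h) e2 scale0r addr0 opprK.
Qed.

(** d eta is of type (1,1). *)
Lemma extd_phi X Y : extd eta (phi X) (phi Y) = extd eta X Y.
Proof.
by rewrite !(sasakian_metric HS) (sasakian_compat HS) eta_phi mulr0 subr0.
Qed.

Lemma extd_phil X Y : extd eta (phi X) Y = - extd eta X (phi Y).
Proof.
by rewrite !(sasakian_metric HS) flat_skew mulrN.
Qed.

Lemma eta_lie X Y : eta X = 0 -> eta Y = 0 -> eta (lie X Y) = - extd eta X Y.
Proof. by move=> h1 h2; rewrite /extd h1 h2 !vfield0 subrr sub0r opprK. Qed.

(** On ker eta, eta([X,Y]) = - d eta(X,Y), and d eta vanishes on pairs in T10
    because it has type (1,1). *)
Lemma T10_lie_closed : lie_closed T10.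
Proof.
move=> X Y DX DY; apply/T10E.
move: DX DY => /[dup] DX /T10E[PX X1 X2] /[dup] DY /T10E[PY Y1 Y2].
split; first exact: T10xi_lie_closed.
  by rewrite /= oneformB !eta_lie // -DX.1 -DY.1 extd_phi opprK addNr.
by rewrite /= oneformD !eta_lie // -DX.1 -DY.1 extd_phil opprK subrr.
Qed.

(** * The generalized structures of a Sasakian manifold *)

(** E^(1,0) splits because Phi is block diagonal; on forms the equation is
    - phi^* w = i w. *)
Lemma E10_Phi (W1 W2 : vfield M) (w1 w2 : oneform M) :
  E10 (Phi_of phi) ((W1, w1), (W2, w2)) <->
  T10 (W1, W2) /\
  (forall X, w1 (phi X) = w2 X) /\ (forall X, w2 (phi X) = - w1 X).
Proof.
split=> [[]|[[h1 h2] [h3 h4]]].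
  move=> /[dup] /(congr1 fst) h1 /(congr1 snd) h2.
  move=> /[dup] /(congr1 fst) h3 /(congr1 snd) h4.
  split; first by [].
  split=> X.
    by have /(congr1 (fun al : oneform M => - (al X))) := h2; rewrite !opprK.
  by have /(congr1 (fun al : oneform M => - (al X))) := h4; rewrite opprK.
split; apply: gsec_ext => //=; apply: oneform_ext => X.
  by change (- w1 (phi X) = - w2 X); rewrite h3.
by change (- w2 (phi X) = w1 X); rewrite h4 opprK.
Qed.

(** The eigenvalue equation for a form in the annihilator is obtained by testing
    it on the sections Y - i phi Y, with Y an arbitrary real vector field. *)
Lemma dirac_sub_T10xi (z : csec M) :
  dirac_sub T10xi z <-> Lbundle (Phi_of phi) (xi, 0) z.
Proof.
case: z => [[X1 a1] [X2 a2]]; split.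
- move=> [/= DX aD].
  have aphi Y : a1 Y = - a2 (phi Y) /\ a1 (phi Y) = a2 Y.
    have /aD[/=] : T10xi (Y, - phi Y) by rewrite /T10xi /= linearN.
    by rewrite !oneformN => -> /oppr_inj ->.
  exists (eta X1), (eta X2), ((X1 - eta X1 *: xi, a1), (X2 - eta X2 *: xi, a2)).
  split.
    apply/E10_Phi; split; last first.
      by split=> X; have [h1 h2] := aphi X; rewrite ?h1 ?h2 ?opprK.
    apply/T10E; split=> /=.
    + rewrite /T10xi /= !linearB !linearZ /= phi_xi.
      by rewrite !(linear0, oppr0, scaler0, addr0); exact: DX.
    + by rewrite oneformB oneformZ eta_xi mulr1 subrr.
    + by rewrite oneformB oneformZ eta_xi mulr1 subrr.
  congr pair; apply: gsec_ext => /=.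
  + by rewrite addrC subrK.
  + by rewrite scaler0 add0r.
  + by rewrite addrC subrK.
  + by rewrite scaler0 add0r.
- move=> [a [b [[[W1 w1] [W2 w2]] [/E10_Phi[[h1 h2] [h3 h4]]]]]].
  move=> [-> -> -> ->]; rewrite /dirac_sub /= !scaler0 !add0r; split.
    rewrite /T10xi /= !linearD !linearZ /= phi_xi !scaler0 !add0r.
    rewrite linear0 oppr0 scaler0 add0r.
    by have /T10E[] : T10 (W1, W2) by split.
  case=> Y1 Y2; rewrite /T10xi /= => DY.
  split; first by rewrite -(h3 Y2) DY oneformN h3 h4 opprK.
  by rewrite -[w1 Y2]opprK -(h4 Y2) DY oneformN !opprK h4 h3.
Qed.

(** The annihilator of T10 also contains eta, so the form is corrected by its
    value on xi; it is tested on the sections - phi^2 Y - i phi Y, twice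
    the projections to T10 of real vector fields. *)
Lemma dirac_sub_T10 (z : csec M) :
  dirac_sub T10 z <-> Lbundle (Phi_of phi) (0, eta) z.
Proof.
case: z => [[X1 a1] [X2 a2]]; split.
- move=> [/= DX aD].
  have aphi Y : a1 Y - a1 xi * eta Y = - a2 (phi Y) /\
      a1 (phi Y) = a2 Y - a2 xi * eta Y.
    have /aD[/=] : T10 (- phi (phi Y), - phi Y).
      by split; rewrite /= linearN // phi3 opprK.
    rewrite phi2 opprD opprK oneformB !oneformZ !oneformN oneformB !oneformZ.
    by rewrite ![eta Y * _]mulrC => -> /oppr_inj ->.
  exists (a1 xi), (a2 xi), ((X1, a1 - a1 xi *: eta), (X2, a2 - a2 xi *: eta)).
  split.
    apply/E10_Phi; split=> //; split=> X; have [h1 h2] := aphi X.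
      by rewrite !oneformE /= eta_phi mulr0 subr0; exact: h2.
    by rewrite !oneformE /= eta_phi mulr0 subr0 h1 opprK.
  congr pair; apply: gsec_ext => /=.
  + by rewrite scaler0 add0r.
  + by rewrite addrC subrK.
  + by rewrite scaler0 add0r.
  + by rewrite addrC subrK.
- move=> [a [b [[[W1 w1] [W2 w2]] [/E10_Phi[DW [h3 h4]]]]]].
  move=> [-> -> -> ->]; rewrite /dirac_sub /= !scaler0 !add0r; split=> //.
  case=> Y1 Y2 /[dup] [[/= k1 k2]] /T10E[_ /= e1 e2].
  change (a * eta Y1 + w1 Y1 = b * eta Y2 + w2 Y2 /\
    a * eta Y2 + w1 Y2 = - (b * eta Y1 + w2 Y1)).
  rewrite e1 e2 !mulr0 !add0r.
  by rewrite -k1 h3 h4 opprK.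
Qed.

Lemma sasakian_gen_almost_contact :
  gen_almost_contact (Phi_of phi) ((xi, 0) : gsec M) ((0, eta) : gsec M).
Proof.
split.
- move=> h [X al] [Y be]; apply: gsec_ext; first exact: linearP.
  apply: oneform_ext => Z.
  change (- (h * al (phi Z) + be (phi Z)) = h * - al (phi Z) - be (phi Z)).
  by rewrite mulrN opprD.
- move=> [X al] [Y be].
  change (Defs.half M * (be (phi X) - al (phi Y)) =
    Defs.half M * (- - be (phi X) + al (- phi Y))).
  by rewrite opprK oneformN.
- move=> [X al]; apply: gsec_ext.
    change (phi (phi X) = - X + (2%:R * (Defs.half M * (al 0 + eta X))) *: xi
      + (2%:R * (Defs.half M * (al xi + 0))) *: 0).
    rewrite oneform0 add0r mulrA (mulrC 2%:R) half2 mul1r scaler0 addr0.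
    exact: phi2.
  apply: oneform_ext => Y.
  change (- - al (phi (phi Y)) =
    - al Y + (2%:R * (Defs.half M * (al 0 + eta X))) * 0
      + (2%:R * (Defs.half M * (al xi + 0))) * eta Y).
  rewrite mulr0 !addr0 mulrA (mulrC 2%:R) half2 mul1r.
  by rewrite opprK phi2 oneformD oneformN oneformZ mulrC.
- by change (Defs.half M * (0 + 0) = 0); rewrite addr0 mulr0.
- by rewrite /pairing /= oneform0 addr0 mulr0.
- change (2%:R * (Defs.half M * (eta xi + 0)) = 1).
  by rewrite eta_xi addr0 mulr1 mulrC half2.
Qed.

Lemma sasakian_normal_gen_contact :
  normal_gen_contact (Phi_of phi) ((xi, 0) : gsec M) ((0, eta) : gsec M).
Proof.
split.
- exact: sasakian_gen_almost_contact.
- exact: courant_closed_ext dirac_sub_T10xi (dirac_sub_closed T10xi_lie_closed).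
- exact: courant_closed_ext dirac_sub_T10 (dirac_sub_closed T10_lie_closed).
- apply: gsec_ext; first exact: lie0r.
  apply: oneform_ext => Y; rewrite courant_formE /= eta_xi.
  change (xi (eta Y) - eta (lie xi Y) - (0 - 0)
    - Defs.half M * (Y 1 - Y 0) = 0).
  rewrite vfield1 vfield0 !subr0 mulr0 subr0.
  by have := sasakian_reeb0 HS Y; rewrite /extd eta_xi vfield1 subr0.
Qed.

Lemma sasakian_normal_gen_contact_metric :
  normal_gen_contact_metric (Phi_of phi) ((xi, 0) : gsec M)
    ((0, eta) : gsec M) (G_of g).
Proof.
split; [exact: sasakian_normal_gen_contact|exact: G_of_gen_metric|].
move=> [X al]; apply: gsec_ext.
  change (- phi (sharp g (- pullback phi al)) =
    sharp g al - (2%:R * (Defs.half M * (al xi + 0))) *: xi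
      - (2%:R * (Defs.half M * (al 0 + eta X))) *: 0).
  have -> : - pullback phi al = g (phi (sharp g al)).
    by apply: oneform_ext => Y; rewrite flat_skew sharpK.
  rewrite flatK phi2 -flat_xi Defs.metric_sym sharpK.
  rewrite addr0 mulrA (mulrC 2%:R) half2 mul1r scaler0 subr0.
  by rewrite opprD opprK.
apply: oneform_ext => Y.
change (- - g (phi X) (phi Y) =
  g X Y - (2%:R * (Defs.half M * (al xi + 0))) * 0
    - (2%:R * (Defs.half M * (al 0 + eta X))) * eta Y).
rewrite opprK (sasakian_compat HS) mulr0 subr0 oneform0 add0r.
by rewrite mulrA (mulrC 2%:R) half2 mul1r.
Qed.

Lemma sasakian_d_eta_neq0 : (0 < n)%N -> ~ (forall X Y, extd eta X Y = 0).
Proof.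
move=> n_gt0 d0; have [p _] := @points_nonempty _ _ M.
have [X /eqP] := sasakian_contact HS p; apply.
rewrite /contact_volume big1// => s _.
by rewrite (bigD1 (Ordinal n_gt0)) //= d0 mul0r !mulr0.
Qed.

End SasakianTensors.

Theorem theorem5p4 (R : realType) (n : nat) (n_gt0 : (0 < n)%N)
    (M : manifold R (n.*2).+1)
    (phi : {linear vfield M -> vfield M}) (eta : oneform M) (xi : vfield M)
    (g : riem_metric M) :
  sasakian phi eta xi g ->
  gen_sasakian (Phi_of phi) ((xi, 0) : gsec M) ((0, eta) : gsec M) (G_of g).
Proof.
move=> HS; split; first exact: sasakian_normal_gen_contact_metric.
  by rewrite /= add0r; exact: sasakian_d_eta_neq0 HS n_gt0.
move=> t.
pose pi := pi_M (Phi_of phi) ((xi, 0) : gsec M) ((0, eta) : gsec M).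
(* Phi is block diagonal, so it has no T*M -> TM component, and pr_TM eta = 0
   kills the wedge e_+ /\ e_- *)
have pi0 al : pi al = 0.
  rewrite /pi /pi_M /bivector /= linear0 oneform0 scaler0 scale0r.
  by rewrite subrr addr0.
have id_map (al : oneform M) : al + (expR t *: (1 : cinf M) : cinf M) *:
    contract_extd (0 + eta) (pi al) = al.
  rewrite pi0; apply: oneform_ext => Y.
  change (al Y + (expR t *: (1 : cinf M) : cinf M) * extd (0 + eta) 0 Y = al Y).
  by rewrite /extd lieC lie0r oppr0 !oneform0 vfield0 vzeroE !subr0 mulr0 addr0.
by exists id => al; rewrite id_map.
Qed.
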